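(* Let $(X,Y,\langle\cdot,\cdot\rangle)$ be an asymmetric dual pair, with $X$ carrying the topology $\sigma(X,Y)$. If $(X,\sigma_s(X,Y))$ is Lindelöf, then a countably compact subset $A\subseteq X$ is compact if and only if $$\mathrm{cl}_{\sigma_s(X,Y)}A\subseteq\ \downarrow A,$$ where $\downarrow A$ denotes the downward closure of $A$ in the partial order $\le$ on $X$ given by $x\le x'\iff\langle x,y\rangle\le\langle x',y\rangle$ for all $y\in Y$.
   Context: All vector spaces and cones are over the reals; a cone is a commutative monoid $(Y,+,0)$ with a scalar multiplication by nonnegative reals satisfying the usual vector space axioms. An asymmetric dual pair $(X,Y,\langle\cdot,\cdot\rangle)$ consists of a vector space $X$, a cone $Y$ and a map $\langle\cdot,\cdot\rangle:X\times Y\to\mathbb R$ that is bilinear (with respect to nonnegative scalars in the second variable) and nondegenerate: $\langle x,\cdot\rangle=0$ implies $x=0$, and $\langle\cdot,y\rangle=\langle\cdot,z\rangle$ implies $y=z$. $\sigma(X,Y)$ is the topology on $X$ with basis the sets $\{x'\in X:\langle x'-x,y\rangle<\epsilon\ \forall y\in F\}$, with $x\in X$, $\epsilon>0$, $F\subseteq Y$ finite. $\overline\sigma(X,Y)$ is the conjugate topology, with basis the sets $\{x'\in X:\langle x-x',y\rangle<\epsilon\ \forall y\in F\}$. $\sigma_s(X,Y)$ is the smallest topology containing both $\sigma(X,Y)$ and $\overline\sigma(X,Y)$. Topological spaces are not assumed Hausdorff. A set is compact (resp. countably compact) if every open cover (resp. countable open cover) has a finite subcover; a space is Lindelöf if every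 open cover has a countable subcover. Compactness and countable compactness refer to $\sigma(X,Y)$. The downward closure is $\downarrow A=\{x\in X:\exists a\in A,\ x\le a\}$. *)

(* Defs.v *)
From HB Require Import structures.
From mathcomp Require Import all_boot all_order all_algebra.
From mathcomp Require Import all_classical all_reals all_analysis.
Set Implicit Arguments.
Unset Strict Implicit.
Unset Printing Implicit Defensive.
Import Order.TTheory GRing.Theory Num.Theory.
Local Open Scope classical_set_scope.
Local Open Scope ring_scope.

(* The semiring of nonnegative reals; a cone is an [lSemiModType] over it. *)
Definition nonneg_real (R : realType) := {x : R | x \is Num.nneg}.
HB.instance Definition _ (R : realType) := SubChoice.on (nonneg_real R).
HB.instance Definition _ (R : realType) :=
  [SubChoice_isSubComNzSemiRing of nonneg_real R by <:].

Record asym_dual_pair (R : realType) (X : lmodType R)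
    (Y : lSemiModType (nonneg_real R)) := AsymDualPair {
  pairing :> X -> Y -> R;
  pairingDl : forall x x' y, pairing (x + x') y = pairing x y + pairing x' y;
  pairingZl : forall (a : R) x y, pairing (a *: x) y = a * pairing x y;
  pairingDr : forall x y y', pairing x (y + y') = pairing x y + pairing x y';
  pairingZr : forall (a : nonneg_real R) x y,
    pairing x (a *: y) = val a * pairing x y;
  pairing_nondegl : forall x, (forall y, pairing x y = 0) -> x = 0;
  pairing_nondegr : forall y z, (forall x, pairing x y = pairing x z) -> y = z
}.

(* The topologies live on aliases of [X], indexed by the pairing. *)
Definition sigma (R : realType) (X : lmodType R)
  (Y : lSemiModType (nonneg_real R)) (b : asym_dual_pair X Y) : Type := X.
Definition sigma_conj (R : realType) (X : lmodType R)
  (Y : lSemiModType (nonneg_real R)) (b : asym_dual_pair X Y) : Type := X.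

Section topologies.
Context {R : realType} {X : lmodType R} {Y : lSemiModType (nonneg_real R)}.
Variable b : asym_dual_pair X Y.

Definition sigma_base : set (set X) :=
  [set U | exists x (e : R) (F : set Y), [/\ 0 < e, finite_set F &
     U = [set x' | forall y, F y -> b (x' - x) y < e]]].

Definition sigma_conj_base : set (set X) :=
  [set U | exists x (e : R) (F : set Y), [/\ 0 < e, finite_set F &
     U = [set x' | forall y, F y -> b (x - x') y < e]]].

Lemma finite_slack (Z : Type) (F : set Z) (g : Z -> R) (e : R) :
    finite_set F -> (forall y, F y -> g y < e) ->
  exists2 d, 0 < d & forall y, F y -> g y + d <= e.
Proof.
move=> /finite_setP[n].
elim: n F => [|n IHn] F.
  by rewrite II0 card_eq0 => /eqP -> _; exists 1.
move=> /eq_cardSP[z Fz FDz] gF.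
have [y [Fy _]|d d0 dF] := IHn _ FDz; first exact: gF.
exists (Num.min d (e - g z)); first by rewrite lt_min d0 subr_gt0 gF.
move=> y Fy; have [->|yz] := pselect (y = z).
  by rewrite -lerBrDl ge_min lexx orbT.
by apply: le_trans (dF y _) => //; rewrite lerD2l ge_min lexx.
Qed.

Lemma sigma_base_cover : \bigcup_(U in sigma_base) U = [set: X].
Proof.
rewrite -subTset => x _; exists setT => //.
by exists 0, 1, set0; split=> //; apply/seteqP; split=> // z _ y [].
Qed.

Lemma sigma_conj_base_cover : \bigcup_(U in sigma_conj_base) U = [set: X].
Proof.
rewrite -subTset => x _; exists setT => //.
by exists 0, 1, set0; split=> //; apply/seteqP; split=> // z _ y [].
Qed.

Lemma pairing_triangle x x' x'' y : b (x - x'') y = b (x - x') y + b (x' - x'') y.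
Proof. by rewrite -pairingDl addrA subrK. Qed.

Lemma pairing_diag x y : b (x - x) y = 0.
Proof. by apply: (addrI (b (x - x) y)); rewrite -pairing_triangle addr0. Qed.

Lemma sigma_base_join (U V : set X) (t : X) :
    sigma_base U -> sigma_base V -> U t -> V t ->
  exists W, [/\ sigma_base W, W t & W `<=` U `&` V].
Proof.
move=> [x1 [e1 [F1 [e10 fF1 ->]]]] [x2 [e2 [F2 [e20 fF2 ->]]]] /= t1 t2.
have [d1 d10 d1F] := finite_slack fF1 t1.
have [d2 d20 d2F] := finite_slack fF2 t2.
have d0 : 0 < Num.min d1 d2 by rewrite lt_min d10.
exists [set x' | forall y, (F1 `|` F2) y -> b (x' - t) y < Num.min d1 d2].
split; first by exists t, (Num.min d1 d2), (F1 `|` F2); rewrite finite_setU.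
- by move=> y _; rewrite pairing_diag.
- move=> x' /= tx'; split=> y Fy; rewrite (pairing_triangle _ t) addrC.
    apply: lt_le_trans (d1F y Fy); rewrite ltrD2l.
    by have := tx' y (or_introl Fy); rewrite lt_min => /andP[].
  apply: lt_le_trans (d2F y Fy); rewrite ltrD2l.
  by have := tx' y (or_intror Fy); rewrite lt_min => /andP[].
Qed.

Lemma sigma_conj_base_join (U V : set X) (t : X) :
    sigma_conj_base U -> sigma_conj_base V -> U t -> V t ->
  exists W, [/\ sigma_conj_base W, W t & W `<=` U `&` V].
Proof.
move=> [x1 [e1 [F1 [e10 fF1 ->]]]] [x2 [e2 [F2 [e20 fF2 ->]]]] /= t1 t2.
have [d1 d10 d1F] := finite_slack fF1 t1.
have [d2 d20 d2F] := finite_slack fF2 t2.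
have d0 : 0 < Num.min d1 d2 by rewrite lt_min d10.
exists [set x' | forall y, (F1 `|` F2) y -> b (t - x') y < Num.min d1 d2].
split; first by exists t, (Num.min d1 d2), (F1 `|` F2); rewrite finite_setU.
- by move=> y _; rewrite pairing_diag.
- move=> x' /= tx'; split=> y Fy; rewrite (pairing_triangle _ t).
    apply: lt_le_trans (d1F y Fy); rewrite ltrD2l.
    by have := tx' y (or_introl Fy); rewrite lt_min => /andP[].
  apply: lt_le_trans (d2F y Fy); rewrite ltrD2l.
  by have := tx' y (or_intror Fy); rewrite lt_min => /andP[].
Qed.

HB.instance Definition _ := Choice.on (sigma b).
HB.instance Definition _ := isBaseTopological.Build (sigma b)
  sigma_base_cover sigma_base_join.

HB.instance Definition _ := Choice.on (sigma_conj b).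
HB.instance Definition _ := isBaseTopological.Build (sigma_conj b)
  sigma_conj_base_cover sigma_conj_base_join.

Definition sigma_family (i : bool) : Topological X :=
  if i then Topological.class (sigma b) else Topological.class (sigma_conj b).

Definition sigma_s := sup_topology sigma_family.
HB.instance Definition _ := Topological.on sigma_s.

Definition dual_le (x x' : X) : Prop := forall y : Y, b x y <= b x' y.

Definition down_closure (A : set X) : set X :=
  [set x | exists2 a, A a & dual_le x a].

End topologies.

(* [countable] includes the finite case. *)
Definition countably_compact (T : topologicalType) (A : set T) : Prop :=
  forall (I : choiceType) (D : set I) (f : I -> set T),
    countable D -> (forall i, D i -> open (f i)) -> A `<=` cover D f ->
    finite_subset_cover D f A.

Definition lindelof (T : topologicalType) : Prop :=
  forall (I : choiceType) (D : set I) (f : I -> set T),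
    (forall i, D i -> open (f i)) -> [set: T] `<=` cover D f ->
    exists D' : set I, [/\ D' `<=` D, countable D' & [set: T] `<=` cover D' f].

(* Main.v *)
Require Import Defs.
From HB Require Import structures.
From mathcomp Require Import all_boot all_order all_algebra.
From mathcomp Require Import all_classical all_reals all_analysis.
From mathcomp Require Import finmap lra.
Import Order.TTheory GRing.Theory Num.Theory.
Local Open Scope classical_set_scope.
Local Open Scope ring_scope.

(** Why the theorem holds.  Every [sigma]-open set is a lower set for
    [dual_le] ([sigma_open_lower]), so an open cover of [A] automatically covers
    the whole of [down_closure b A].

    If the [sigma_s]-closure of [A] lies in the down-closure, then a
    [sigma]-open cover of [A] covers that closure, and it is also a cover by
    [sigma_s]-open sets ([sigma_open_sigma_s]).  A closed subset of a Lindelof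
    space is Lindelof ([lindelof_closed]), so countably many members suffice,
    and countable compactness of [A] cuts them down to finitely many.

    Conversely, let [A] be compact and suppose that [x] lies below no point of
    [A].  Each [a] in [A] is then separated from [x] by a functional [y a]
    with [b a (y a) < b x (y a)].  With [c a] the midpoint of these two values,
    the half-spaces [b _ (y a) < c a] form a [sigma]-open cover of [A].
    Finitely many of them cover [A], while the intersection of the
    corresponding opposite half-spaces [c a < b _ (y a)] is a
    [sigma_s]-neighbourhood of [x] that misses all of them, hence misses [A].
    So [x] is not in the [sigma_s]-closure of [A]. *)

(** The complement of [C] joins the cover under the extra index [None] and is
    dropped again from the countable subcover, since it covers no point of
    [C]. *)
Lemma lindelof_closed {T : topologicalType} {C : set T} {I : choiceType}
    {D : set I} {f : I -> set T} :
    lindelof T -> closed C -> (forall i, D i -> open (f i)) ->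
    C `<=` cover D f ->
  exists D' : set I, [/\ D' `<=` D, countable D' & C `<=` cover D' f].
Proof.
move=> LT clC fop Cf.
pose g (o : option I) := if o is Some i then f i else ~` C.
pose E := [set o : option I | if o is Some i then D i else True].
have gop o : E o -> open (g o).
  by case: o => [i /fop//|_]; exact: closed_openC.
have gT : [set: T] `<=` cover E g.
  move=> t _; have [/Cf[i Di fit]|nCt] := pselect (C t).
    by exists (Some i).
  by exists None.
have [E' [E'E cE' E'T]] := LT _ E g gop gT.
exists [set i | E' (Some i)]; split.
- by move=> i /E'E.
- have SE' : Some @` [set i | E' (Some i)] `<=` E' by move=> _ [i ? <-].
  have SomeI : {in [set i | E' (Some i)] &, injective (@Some I)}.
    by move=> i j _ _ [].
  have /card_eqPle[_ leS] := inj_card_eq SomeI.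
  exact/(sub_countable _ cE')/(card_le_trans leS)/subset_card_le.
- by move=> t Ct; have [[i|] E'i git] := E'T t Logic.I; [exists i|].
Qed.

Section asym_dual_pair_topologies.
Context {R : realType} {X : lmodType R} {Y : lSemiModType (nonneg_real R)}.
Variable b : asym_dual_pair X Y.

Lemma pairingBl x x' y : b (x - x') y = b x y - b x' y.
Proof. by rewrite -scaleN1r pairingDl pairingZl mulN1r. Qed.

(** Basic open sets bound the functionals from above only, and decreasing a
    point preserves such bounds. *)
Lemma sigma_open_lower (U : set (sigma b)) (x x' : X) :
  open U -> dual_le b x' x -> U x -> U x'.
Proof.
move=> [B /= Bbase <-] lex [W BW Wx]; exists W => //; move: Wx.
have [z [e [F [_ _ ->]]]] := Bbase W BW => /= xF y Fy.
by apply: le_lt_trans (xF y Fy); rewrite !pairingBl lerD2r.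
Qed.

Lemma sigma_halfspace_open (y : Y) (c : R) :
  open ([set z | b z y < c] : set (sigma b)).
Proof.
exists [set W | sigma_base b W /\ W `<=` [set z | b z y < c]]; first by move=> ? [].
apply/seteqP; split=> [z [W [_ sub] Wz]|z /= zc]; first exact: sub.
exists [set x' | forall y', [set y] y' -> b (x' - z) y' < c - b z y]; last first.
  by move=> _ ->; rewrite pairing_diag subr_gt0.
split; first by exists z, (c - b z y), [set y]; rewrite subr_gt0.
by move=> x' /(_ y erefl); rewrite pairingBl ltrD2r.
Qed.

Lemma sigma_conj_halfspace_open (y : Y) (c : R) :
  open ([set z | c < b z y] : set (sigma_conj b)).
Proof.
exists [set W | sigma_conj_base b W /\ W `<=` [set z | c < b z y]].
  by move=> ? [].
apply/seteqP; split=> [z [W [_ sub] Wz]|z /= zc]; first exact: sub.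
exists [set x' | forall y', [set y] y' -> b (z - x') y' < b z y - c]; last first.
  by move=> _ ->; rewrite pairing_diag subr_gt0.
split; first by exists z, (b z y - c), [set y]; rewrite subr_gt0.
by move=> x' /(_ y erefl); rewrite pairingBl /= => ?; lra.
Qed.

Lemma nbhs_sigma_s (x : X) (U : set X) :
    @nbhs _ (sigma b) x U \/ @nbhs _ (sigma_conj b) x U ->
  @nbhs _ (sigma_s b) x U.
Proof.
have /(cvg_sup (sigma_family b) (F := nbhs (x : sigma_s b))) cvgx :
  nbhs (x : sigma_s b) --> (x : sigma_s b) by [].
by case; [exact: cvgx true U | exact: cvgx false U].
Qed.

Lemma sigma_open_sigma_s (U : set X) :
  @open (sigma b) U -> @open (sigma_s b) U.
Proof.
move=> Uop; rewrite openE => x Ux.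
by apply: nbhs_sigma_s; left; exact: open_nbhs_nbhs.
Qed.

Lemma cover_compact_closure_sub_down (A : set X) :
    @cover_compact (sigma b) A ->
  @closure (sigma_s b) A `<=` down_closure b A.
Proof.
move=> Aco x clAx; apply: contrapT => xA.
have sep a : exists y, A a -> b a y < b x y.
  have [Aa|?] := pselect (A a); last by exists 0.
  have /existsNP[y /negP] : ~ dual_le b x a by move=> xa; apply: xA; exists a.
  by rewrite -ltNge; exists y.
have [y yP] := choice sep.
(* The midpoint leaves strict inequalities on both sides, so that opposite open
   half-spaces separate [a] from [x]. *)
pose c a := (b a (y a) + b x (y a)) / 2.
have cP a : A a -> b a (y a) < c a < b x (y a).
  by move=> /yP; rewrite /c => ?; apply/andP; split; lra.
have [|a Aa|D DA AD] := Aco X A (fun a => [set z | b z (y a) < c a]).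
- by move=> a _; exact: sigma_halfspace_open.
- by exists a => //=; have /andP[] := cP a Aa.
have Vx : @nbhs _ (sigma_s b) x
    (\bigcap_(a in [set` D]) [set z | c a < b z (y a)]).
  apply: filter_bigI => a /DA /set_mem Aa; apply: nbhs_sigma_s; right.
  apply: open_nbhs_nbhs; split; first exact: sigma_conj_halfspace_open.
  by have /andP[] := cP a Aa.
have [z [/AD[a Da /= zc] Vz]] := clAx _ Vx.
by have := lt_trans zc (Vz a Da); rewrite ltxx.
Qed.

Lemma closure_sub_down_cover_compact (A : set X) :
    lindelof (sigma_s b) -> @countably_compact (sigma b) A ->
    @closure (sigma_s b) A `<=` down_closure b A ->
  @cover_compact (sigma b) A.
Proof.
move=> Ls Acc clA I D f fop Af.
have clf : @closure (sigma_s b) A `<=` cover D f.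
  move=> x /clA[a /Af[i Di fia] xa]; exists i => //.
  exact: sigma_open_lower (fop i Di) xa fia.
have [D' [D'D cD' clD']] := lindelof_closed Ls (@closed_closure _ _)
  (fun i Di => sigma_open_sigma_s _ (fop i Di)) clf.
have AD' : A `<=` cover D' f.
  exact: subset_trans (@subset_closure (sigma_s b) A) clD'.
have [E ED' AE] := Acc I D' f cD' (fun i D'i => fop i (D'D i D'i)) AD'.
by exists E => // i /ED'/set_mem/D'D/mem_set.
Qed.

End asym_dual_pair_topologies.

Theorem theorem4p8 (R : realType) (X : lmodType R)
    (Y : lSemiModType (nonneg_real R)) (b : asym_dual_pair X Y) (A : set X) :
  lindelof (sigma_s b) ->
  @countably_compact (sigma b) A ->
  (@cover_compact (sigma b) A <->
   @closure (sigma_s b) A `<=` down_closure b A).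
Proof.
move=> Ls Acc; split; first exact: cover_compact_closure_sub_down.
exact: closure_sub_down_cover_compact.
Qed.
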